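(* Let $V$ be a control Lyapunov function on $\mathcal{D}$ (with class $\mathcal{K}$ function $\alpha_l$) for the system $\dot{\mathbf{x}}=\mathbf{f}(\mathbf{x})+\mathbf{G}(\mathbf{x})\mathbf{u}$, and let $h$ be a control barrier function of $\mathcal{C}=\{\mathbf{x}\in\mathbb{R}^n : h(\mathbf{x})\ge 0\}\subset\mathcal{D}$ on $\mathcal{D}$ (with extended class $\mathcal{K}$ function $\alpha_h$), such that $h(\mathbf{0})>0$ and $\mathcal{L}_{\mathbf{G}}h(\mathbf{x})\ne\mathbf{0}$ for all $\mathbf{x}\in\mathcal{D}$. Put $$F_l(\mathbf{x}):=\mathcal{L}_{\mathbf{f}}V(\mathbf{x})+\alpha_l(V(\mathbf{x})),\qquad F_h(\mathbf{x}):=\mathcal{L}_{\mathbf{f}}h(\mathbf{x})+\alpha_h(h(\mathbf{x})).$$ Assume: (a) $\mathcal{L}_{\mathbf{G}}V(\mathbf{x})\neq\mathbf{0}$ for every $\mathbf{x}\in\mathcal{E}:=\{\mathbf{x}\in\mathcal{D}\setminus\{\mathbf{0}\} : F_l(\mathbf{x})=0\}$; (b) $\mathbf{w}_l\in\mathbb{R}^m$ satisfies $-\mathcal{L}_{\mathbf{G}}V(\mathbf{x})\mathbf{w}_l>0$ for all $\mathbf{x}\in\mathcal{D}\setminus\{\mathbf{0}\}$ such that $\mathcal{L}_{\mathbf{G}}V(\mathbf{x})\ne\mathbf{0}$; (c) $\mathbf{w}_h\in\mathbb{R}^m$ satisfies $\mathcal{L}_{\mathbf{G}}h(\mathbf{x})\mathbf{w}_h>0$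 for all $\mathbf{x}\in\mathcal{D}\setminus\{\mathbf{0}\}$. Then, for all $\mathbf{x}\in\mathcal{D}\setminus\{\mathbf{0}\}$, the solution of the linear complementarity problem in the unknowns $(\bar u_l,\bar u_h)\in\mathbb{R}^2$ $$0\le \bar u_l\ \perp\ -F_l(\mathbf{x})-\mathcal{L}_{\mathbf{G}}V(\mathbf{x})\mathbf{w}_l\bar u_l\ \ge 0,$$ $$0\le \bar u_h\ \perp\ F_h(\mathbf{x})+\mathcal{L}_{\mathbf{G}}h(\mathbf{x})\,[\mathbf{w}_l\bar u_l+\mathbf{w}_h\bar u_h]\ \ge 0,$$ is unique and has the closed form $$\bar u_l=\begin{cases}-\dfrac{F_l(\mathbf{x})}{\mathcal{L}_{\mathbf{G}}V(\mathbf{x})\mathbf{w}_l}, & F_l(\mathbf{x})\ge 0,\\[2mm] 0,& F_l(\mathbf{x})<0,\end{cases}\qquad \bar u_h=\left(-\frac{F_h(\mathbf{x})+\mathcal{L}_{\mathbf{G}}h(\mathbf{x})\mathbf{w}_l\bar u_l}{\mathcal{L}_{\mathbf{G}}h(\mathbf{x})\mathbf{w}_h}\right)_+ .$$ If, moreover, $\nabla V(\mathbf{x})$ and $\nabla h(\mathbf{x})$ are locally Lipschitz continuous for all $\mathbf{x}\in\mathcal{D}\setminus\{\mathbf{0}\}$ and the functions $\alpha_l$ and $\alpha_h$ are locally Lipschitz continuous, then $\bar u_l$ and $\bar u_h$ are locally Lipschitz continuous for all $\mathbf{x}\in\mathcal{D}\setminus\{\mathbf{0}\}$.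
   Context: Setting. The control-affine system is $\dot{\mathbf{x}}=\mathbf{f}(\mathbf{x})+\mathbf{G}(\mathbf{x})\mathbf{u}$ with state $\mathbf{x}\in\mathbb{R}^n$ and input $\mathbf{u}\in\mathbb{R}^m$, where $\mathbf{f}:\mathbb{R}^n\to\mathbb{R}^n$ and $\mathbf{G}:\mathbb{R}^n\to\mathbb{R}^{n\times m}$ are locally Lipschitz continuous and $\mathbf{f}(\mathbf{0})=\mathbf{0}$. The set $\mathcal{D}\subseteq\mathbb{R}^n$ is open and connected with $\mathbf{0}\in\mathcal{D}$. The input is parameterized as $\mathbf{u}=\mathbf{w}_l\bar u_l+\mathbf{w}_h\bar u_h$, with direction vectors $\mathbf{w}_l,\mathbf{w}_h\in\mathbb{R}^m$ (which may depend on $\mathbf{x}$; for example $\mathbf{w}_l=-\mathcal{L}_{\mathbf{G}}V(\mathbf{x})^\top$, $\mathbf{w}_h=\mathcal{L}_{\mathbf{G}}h(\mathbf{x})^\top$) and scalar magnitudes $\bar u_l,\bar u_h$. Notation. For a continuously differentiable $\phi:\mathbb{R}^n\to\mathbb{R}$, $\mathcal{L}_{\mathbf{f}}\phi(\mathbf{x})=\nabla \phi(\mathbf{x})^\top\mathbf{f}(\mathbf{x})\in\mathbb{R}$ and $\mathcal{L}_{\mathbf{G}}\phi(\mathbf{x})=\nabla \phi(\mathbf{x})^\top\mathbf{G}(\mathbf{x})$ (a row vector in $\mathbb{R}^{1\times m}$). $(s)_+=\max(s,0)$. For scalars, $0\le a\perp b\ge0$ means $a\ge0$, $b\ge0$ and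 $ab=0$. A class $\mathcal{K}$ function $\mathbb{R}_{\ge0}\to\mathbb{R}_{\ge0}$ is continuous, strictly increasing and zero at $0$; an extended class $\mathcal{K}$ function $\mathbb{R}\to\mathbb{R}$ is continuous, strictly increasing and zero at $0$. Control Lyapunov function (CLF). A continuously differentiable positive-definite $V:\mathbb{R}^n\to\mathbb{R}$ is a CLF on $\mathcal{D}$, with class $\mathcal{K}$ function $\alpha_l$, if $\inf_{\mathbf{u}\in\mathbb{R}^m}[\mathcal{L}_{\mathbf{f}}V(\mathbf{x})+\mathcal{L}_{\mathbf{G}}V(\mathbf{x})\mathbf{u}]\le-\alpha_l(V(\mathbf{x}))$ for each $\mathbf{x}\in\mathcal{D}\setminus\{\mathbf{0}\}$. Control barrier function (CBF). A continuously differentiable $h:\mathbb{R}^n\to\mathbb{R}$ is a CBF of $\mathcal{C}=\{\mathbf{x}:h(\mathbf{x})\ge0\}$ on $\mathcal{D}$, with extended class $\mathcal{K}$ function $\alpha_h$, if $\sup_{\mathbf{u}\in\mathbb{R}^m}[\mathcal{L}_{\mathbf{f}}h(\mathbf{x})+\mathcal{L}_{\mathbf{G}}h(\mathbf{x})\mathbf{u}]\ge-\alpha_h(h(\mathbf{x}))$ for all $\mathbf{x}\in\mathcal{D}$.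
   Formalization: For the final local Lipschitz claim, the directions w_l and w_h, which may depend on x, are additionally assumed locally Lipschitz on D\{0}; this is automatic for constant vectors, and the claim fails for discontinuous w_l. *)

(* Defs.v *)
(* MathComp-Analysis, over an arbitrary R : realType. R^n is 'cV[R]_n with the
   library's sup norm; continuity, differentiability and local Lipschitz
   continuity do not depend on the choice of norm. *)
From HB Require Import structures.
From mathcomp Require Import all_boot all_order all_algebra.
From mathcomp Require Import all_classical all_reals all_analysis.

Set Implicit Arguments.
Unset Strict Implicit.
Unset Printing Implicit Defensive.

Import Order.TTheory GRing.Theory Num.Theory.
Import numFieldNormedType.Exports.

Local Open Scope classical_set_scope.
Local Open Scope ring_scope.

(* The library's "locally Lipschitz on A": f is Lipschitz near every point of
   A `*` A, relatively to A `*` A. On the diagonal this is the usual condition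
   (a Lipschitz bound on some neighbourhood of each x in A), and that condition
   implies the bound near off-diagonal points, where |x - y| stays away from 0
   and f is locally bounded. *)
Definition locally_lipschitz (R : realType) (U W : normedModType R)
    (A : set U) (f : U -> W) : Prop :=
  [locally [lipschitz f x | x in A]].

Section LieDerivatives.
Variables (R : realType) (n m : nat).
Implicit Types (phi : 'cV[R]_n -> R) (x : 'cV[R]_n).

Definition gradient phi x : 'cV[R]_n := \col_i 'D_(delta_mx i 0) phi x.

Definition continuously_differentiable phi : Prop :=
  (forall x, differentiable phi x) /\ continuous (gradient phi).

Definition positive_definite phi : Prop :=
  phi 0 = 0 /\ forall x, x != 0 -> 0 < phi x.

Definition lieF (f : 'cV[R]_n -> 'cV[R]_n) phi x : R :=
  ((gradient phi x)^T *m f x) 0 0.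

Definition lieG (G : 'cV[R]_n -> 'M[R]_(n, m)) phi x : 'rV[R]_m :=
  (gradient phi x)^T *m G x.

Definition rowdot (a : 'rV[R]_m) (w : 'cV[R]_m) : R := (a *m w) 0 0.

End LieDerivatives.

Section ComparisonFunctions.
Variable R : realType.

(* A function on the nonnegative reals is a total function R -> R whose values
   at negative arguments are irrelevant; nonnegativity of its values on
   [0, +oo[ follows from the last two clauses. *)
Definition class_K (alpha : R -> R) : Prop :=
  [/\ {within `[0, +oo[%classic, continuous alpha},
      forall s t, 0 <= s -> s < t -> alpha s < alpha t
    & alpha 0 = 0].

Definition extended_class_K (alpha : R -> R) : Prop :=
  [/\ continuous alpha,
      forall s t, s < t -> alpha s < alpha t
    & alpha 0 = 0].

End ComparisonFunctions.

Section ControlFunctions.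
Variables (R : realType) (n m : nat).
Variables (f : 'cV[R]_n -> 'cV[R]_n) (G : 'cV[R]_n -> 'M[R]_(n, m)).
Variable D : set 'cV[R]_n.

(* The infimum and the supremum are taken in \bar R, since they are infinite
   whenever the row vector lieG G V x, resp. lieG G h x, is nonzero. *)
Definition is_CLF (V : 'cV[R]_n -> R) (alpha_l : R -> R) : Prop :=
  [/\ continuously_differentiable V, positive_definite V, class_K alpha_l
    & forall x, (D `\ 0) x ->
        (ereal_inf [set (lieF f V x + rowdot (lieG G V x) u)%:E
                   | u in [set: 'cV[R]_m]] <= (- alpha_l (V x))%:E)%E].

Definition is_CBF (h : 'cV[R]_n -> R) (alpha_h : R -> R) : Prop :=
  [/\ continuously_differentiable h, extended_class_K alpha_h
    & forall x, D x ->
        ((- alpha_h (h x))%:E <=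
         ereal_sup [set (lieF f h x + rowdot (lieG G h x) u)%:E
                   | u in [set: 'cV[R]_m]])%E].

End ControlFunctions.

Section ComplementarityProblem.
Variables (R : realType) (n m : nat).
Variables (f : 'cV[R]_n -> 'cV[R]_n) (G : 'cV[R]_n -> 'M[R]_(n, m)).
Variables (V h : 'cV[R]_n -> R) (alpha_l alpha_h : R -> R).
Variables w_l w_h : 'cV[R]_n -> 'cV[R]_m.

Definition residual (phi : 'cV[R]_n -> R) (alpha : R -> R) (x : 'cV[R]_n) : R :=
  lieF f phi x + alpha (phi x).

Definition complementary (a b : R) : Prop := [/\ 0 <= a, 0 <= b & a * b = 0].

Definition solves_LCP (x : 'cV[R]_n) (ul uh : R) : Prop :=
  complementary ul
    (- residual V alpha_l x - rowdot (lieG G V x) (w_l x) * ul) /\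
  complementary uh
    (residual h alpha_h x +
     rowdot (lieG G h x) (ul *: w_l x + uh *: w_h x)).

Definition ubar_l (x : 'cV[R]_n) : R :=
  if 0 <= residual V alpha_l x
  then - (residual V alpha_l x / rowdot (lieG G V x) (w_l x))
  else 0.

Definition ubar_h (x : 'cV[R]_n) : R :=
  Num.max
    (- ((residual h alpha_h x + rowdot (lieG G h x) (w_l x) * ubar_l x) /
        rowdot (lieG G h x) (w_h x)))
    0.

End ComplementarityProblem.

(* Main.v *)
Require Import Defs.
From HB Require Import structures.
From mathcomp Require Import all_boot all_order all_algebra.
From mathcomp Require Import all_classical all_reals all_analysis.
From mathcomp Require Import ring lra.

(** Why the theorem is true.

    At a fixed x write L for the pairing of the row L_G V with w_l.  The first
    complementarity condition involves u_l alone: it is the scalar problem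
    0 <= u, 0 <= q + M u, u (q + M u) = 0 with q = - F_l and M = - L >= 0.  Such
    a problem has exactly one solution as soon as M > 0, namely max (- q / M, 0)
    ([complementary_affine]), or q > 0, namely 0 ([complementary_slack]).  One of
    the two always holds: if L_G V vanishes at x then the infimum in the CLF
    inequality runs over a constant, so F_l <= 0 ([CLF_residual_le0]), and
    hypothesis (a) excludes equality; otherwise M > 0 by (b).  Once u_l is known,
    the second condition is again a scalar problem, with slope L_G h w_h > 0.

    For the regularity, the point is that the two branches of u_l meet in a
    Lipschitz way.  If F_l >= 0 at a point then L < 0 there, hence nearby, and
    wherever L < 0 both branches of u_l agree with max (- F_l / L, 0)
    ([ubar_l_max]).  If F_l < 0 at a point then F_l < 0 nearby, where u_l is 0.
    What remains is the stability of local Lipschitz continuity under the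
    operations that build u_l and u_h from the data.  The one analytic ingredient
    is that a C^1 function is locally Lipschitz, by the mean value theorem on a
    ball where its gradient is bounded
    ([continuously_differentiable_lipschitz_near]); it is needed because F_l and
    F_h contain alpha_l (V x) and alpha_h (h x).

    All Lipschitz estimates are made for [lipschitz_near], which concerns one
    point; [locally_lipschitzP] identifies it with [locally_lipschitz], whose
    definition also mentions pairs of distinct points. *)

Import Order.TTheory GRing.Theory Num.Theory.
Import numFieldNormedType.Exports.
Local Open Scope classical_set_scope.
Local Open Scope ring_scope.

Set Implicit Arguments.
Unset Strict Implicit.
Unset Printing Implicit Defensive.

(** * Lipschitz continuity near a point *)

Lemma normr_entry (R : realType) n m (M : 'M[R]_(n, m)) i j : `|M i j| <= `|M|.
Proof.
rewrite [leRHS]/Num.norm /= mx_normrE.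
exact: (@le_bigmax _ _ _ 0 (fun p => `|M p.1 p.2|) (i, j)).
Qed.

(** Taking an arbitrary filter lets neighbourhoods in the whole space and
    neighbourhoods relative to a set be treated alike.  Constants with 0 <= k can
    be added and multiplied without a case analysis. *)
Definition lipschitz_near (R : realType) (U W : normedModType R)
    (F : set_system U) (f : U -> W) : Prop :=
  exists2 k : R, 0 <= k &
  exists2 P : set U, F P &
    forall y z, P y -> P z -> `|f y - f z| <= k * `|y - z|.

Section LipschitzNear.
Variables (R : realType) (U : normedModType R).

Lemma locally_lipschitz_near (W : normedModType R) (A : set U) (f : U -> W) x :
  A x -> locally_lipschitz A f -> lipschitz_near (within A (nbhs x)) f.
Proof.
move=> Ax /(_ (x, x) (conj Ax Ax)) /pinfty_ex_gt0[k k0] /= [[P Q] /= [Px Qx] PQ].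
exists k; first exact: ltW.
exists (A `&` (P `&` Q)).
  rewrite /within /=; near=> y => Ay; split => //; split; near: y => //.
by move=> y z [Ay [Py _]] [Az [_ Qz]]; exact: (PQ (y, z)).
Unshelve. all: by end_near. Qed.

(** Products, inverses and composites need more than a Lipschitz bound: they use
    boundedness, separation from 0 and control of the range, which all come from
    continuity at the centre. *)
Lemma lipschitz_near_cvg (W : normedModType R) (A : set U) (f : U -> W) x :
  A x -> lipschitz_near (within A (nbhs x)) f ->
  f @ within A (nbhs x) --> f x.
Proof.
move=> Ax [k k0 [P AP kf]]; apply/cvgrPdist_lt => e e0.
have Px : P x by exact: (nbhs_singleton (AP : nbhs x [set y | A y -> P y]) Ax).
(* The radius is e / (k + 1), not e / k, because k may be 0. *)
have k1 : 0 < k + 1 by rewrite ltr_wpDl.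
have : \forall y \near within A (nbhs x), `|x - y| < e / (k + 1).
  apply: (@cvg_within _ (nbhs _)); apply/nbhs_ballP; exists (e / (k + 1)) => /=.
    by rewrite divr_gt0.
  by move=> y; rewrite -ball_normE.
apply: filterS2 AP => y Py xy.
apply: le_lt_trans (kf _ _ Px Py) _.
rewrite ltr_pdivlMr // in xy.
apply: le_lt_trans xy; rewrite mulrC ler_wpM2l //.
by rewrite lerDl.
Qed.

(** Near a pair of distinct points x and x' the Lipschitz bound is automatic: f
    is continuous at both, so `|f y - f z| is bounded there, while `|y - z| is
    at least a third of `|x - x'|. *)
Lemma locally_lipschitzP (W : normedModType R) (A : set U) (f : U -> W) :
  locally_lipschitz A f <->
  forall x, A x -> lipschitz_near (within A (nbhs x)) f.
Proof.
split=> [fA x Ax|fA [x x'] [/= Ax Ax']]; first exact: locally_lipschitz_near.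
suff [k [P [Q [AP AQ kf]]]] : exists k P Q, [/\ within A (nbhs x) P,
    within A (nbhs x') Q &
    forall y z, P y -> Q z -> `|f y - f z| <= k * `|y - z|].
  exists k; split=> [|M kM]; first exact: num_real.
  exists (fun y => A y -> P y, fun y => A y -> Q y); first by split.
  move=> [y z] /= [Py Qz] [/= Ay Az].
  apply: le_trans (kf _ _ (Py Ay) (Qz Az)) _.
  by apply: ler_wpM2r => //; exact: ltW.
have [<-|xx'] := eqVneq x x'.
  have [k _ [P AP kf]] := fA x Ax.
  by exists k, P, P; split.
pose d := `|x - x'|.
have d0 : 0 < d by rewrite normr_gt0 subr_eq0.
have d3 : 0 < d / 3 by rewrite divr_gt0.
have fx1 := (lipschitz_near_cvg Ax (fA x Ax)).
have fx'1 := (lipschitz_near_cvg Ax' (fA x' Ax')).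
move/cvgrPdist_lt: fx1 => /(_ _ ltr01) fx1.
move/cvgrPdist_lt: fx'1 => /(_ _ ltr01) fx'1.
have near_d (u : U) : \forall y \near within A (nbhs u), `|u - y| < d / 3.
  apply: (@cvg_within _ (nbhs _)); apply/nbhs_ballP; exists (d / 3) => //= y.
  by rewrite -ball_normE.
pose M := `|f x - f x'| + 2.
exists (M / (d / 3)),
  (fun y => `|f x - f y| < 1 /\ `|x - y| < d / 3),
  (fun y => `|f x' - f y| < 1 /\ `|x' - y| < d / 3).
split; [exact: (filterI fx1 (near_d x))|exact: (filterI fx'1 (near_d x'))|].
move=> y z [fy xy] [fz x'z].
have dyz : d / 3 <= `|y - z|.
  have : d <= `|x - y| + (`|y - z| + `|x' - z|).
    rewrite (distrC x' z).
    apply: le_trans (ler_distD y _ _) _; rewrite lerD2l; exact: ler_distD.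
  by move: xy x'z; lra.
have M0 : 0 <= M by rewrite addr_ge0.
rewrite -mulrA; apply: (@le_trans _ _ M); last first.
  by rewrite ler_peMr // mulrC ler_pdivlMr // mul1r.
have : `|f y - f z| <= `|f x - f y| + (`|f x - f x'| + `|f x' - f z|).
  rewrite (distrC (f x) (f y)).
  apply: le_trans (ler_distD (f x) _ _) _; rewrite lerD2l; exact: ler_distD.
by move: fy fz; rewrite /M; lra.
Qed.

Lemma lipschitz_near_within (W : normedModType R) (A : set U) (f : U -> W)
    (x : U) :
  lipschitz_near (nbhs x) f -> lipschitz_near (within A (nbhs x)) f.
Proof.
move=> [k k0 [P xP kf]]; exists k => //; exists P => //.
by move: xP; rewrite /within /=; apply: filterS.
Qed.

Lemma locally_lipschitz_setT_near (W : normedModType R) (A : set U) (f : U -> W)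
    (x : U) : locally_lipschitz setT f -> lipschitz_near (within A (nbhs x)) f.
Proof.
move=> /(locally_lipschitz_near (I : setT x)) [k k0 [P TP kf]].
apply: lipschitz_near_within; exists k => //; exists P => //.
by move: TP; rewrite /within /=; apply: filterS => y; apply.
Qed.

Lemma lipschitz_near_eq (W : normedModType R) (F : set_system U)
    {FF : Filter F} (f g : U -> W) :
  (\forall y \near F, f y = g y) -> lipschitz_near F f -> lipschitz_near F g.
Proof.
move=> fg [k k0 [P FP kf]]; exists k => //.
exists (P `&` [set y | f y = g y]); first exact: filterI.
by move=> y z [Py <-] [Pz <-]; exact: kf.
Qed.

Lemma lipschitz_near_cst (W : normedModType R) (F : set_system U)
    {FF : Filter F} (c : W) : lipschitz_near F (fun=> c).
Proof.
exists 0 => //; exists setT; first exact: filterT.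
by move=> y z _ _; rewrite subrr normr0 mul0r.
Qed.

Lemma lipschitz_nearD (W : normedModType R) (F : set_system U)
    {FF : Filter F} (f g : U -> W) :
  lipschitz_near F f -> lipschitz_near F g ->
  lipschitz_near F (fun y => f y + g y).
Proof.
move=> [k k0 [P FP kf]] [l l0 [Q FQ lg]]; exists (k + l); first exact: addr_ge0.
exists (P `&` Q); first exact: filterI.
move=> y z [Py Qy] [Pz Qz]; rewrite opprD addrACA mulrDl.
by apply: le_trans (ler_normD _ _) _; rewrite lerD ?kf ?lg.
Qed.

Lemma lipschitz_nearN (W : normedModType R) (F : set_system U) (f : U -> W) :
  lipschitz_near F f -> lipschitz_near F (fun y => - f y).
Proof.
move=> [k k0 [P FP kf]]; exists k => //; exists P => // y z Py Pz.
by rewrite -opprD normrN; exact: kf.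
Qed.

Lemma lipschitz_near_sum (W : normedModType R) (F : set_system U)
    {FF : Filter F} (I : finType) (f : I -> U -> W) :
  (forall i, lipschitz_near F (f i)) ->
  lipschitz_near F (fun y => \sum_i f i y).
Proof.
move=> Ff; elim: (index_enum I) => [|i s IHs].
  under [X in lipschitz_near _ X]funext do rewrite big_nil.
  exact: lipschitz_near_cst.
under [X in lipschitz_near _ X]funext do rewrite big_cons.
exact: lipschitz_nearD.
Qed.

Lemma lipschitz_near_comp (W X : normedModType R) (A : set U) (B : set W)
    (g : U -> W) (f : W -> X) x :
  A x -> (forall y, A y -> B (g y)) ->
  lipschitz_near (within A (nbhs x)) g ->
  lipschitz_near (within B (nbhs (g x))) f ->
  lipschitz_near (within A (nbhs x)) (f \o g).
Proof.
move=> Ax AB gx; have gc := lipschitz_near_cvg Ax gx.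
case: gx => [k k0 [P AP kg]] [l l0 [Q BQ lf]].
exists (l * k); first exact: mulr_ge0.
exists (P `&` [set y | B (g y) -> Q (g y)] `&` A).
  have gQ : within A (nbhs x) [set y | B (g y) -> Q (g y)].
    exact: (gc (fun w => B w -> Q w) BQ).
  by apply: filterI (filterI AP gQ) _; exact: withinT.
move=> y z [[Py Qy] Ay] [[Pz Qz] Az] /=.
apply: le_trans (lf _ _ (Qy (AB _ Ay)) (Qz (AB _ Az))) _.
by rewrite -mulrA ler_wpM2l ?kg.
Qed.

Lemma lipschitz_near_entry (F : set_system U) n m (f : U -> 'M[R]_(n, m)) i j :
  lipschitz_near F f -> lipschitz_near F (fun y => f y i j).
Proof.
move=> [k k0 [P FP kf]]; exists k => //; exists P => // y z Py Pz.
apply: le_trans (kf _ _ Py Pz).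
by have := normr_entry (f y - f z) i j; rewrite !mxE.
Qed.

Lemma lipschitz_near_max0 (F : set_system U) (f : U -> R) :
  lipschitz_near F f -> lipschitz_near F (fun y => Num.max (f y) 0).
Proof.
move=> [k k0 [P FP kf]]; exists k => //; exists P => // y z Py Pz.
apply: le_trans (kf _ _ Py Pz).
rewrite !maxEle; case: (leP (f y) 0) => fy; case: (leP (f z) 0) => fz.
- by rewrite subrr normr0.
- by rewrite sub0r normrN gtr0_norm // ler_normr; apply/orP; right; lra.
- by rewrite subr0 gtr0_norm // ler_normr; apply/orP; left; lra.
- by [].
Qed.

Section Products.
Variables (A : set U) (x : U).
Hypothesis Ax : A x.
Let F := within A (nbhs x).

Lemma lipschitz_nearM (f g : U -> R) :
  lipschitz_near F f -> lipschitz_near F g ->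
  lipschitz_near F (fun y => f y * g y).
Proof.
move=> fx gx.
have /cvgrPdist_lt/(_ _ ltr01) fb := lipschitz_near_cvg Ax fx.
have /cvgrPdist_lt/(_ _ ltr01) gb := lipschitz_near_cvg Ax gx.
move: fx gx => [k k0 [P FP kf]] [l l0 [Q FQ lg]].
exists ((`|f x| + 1) * l + (`|g x| + 1) * k).
  by rewrite addr_ge0 // mulr_ge0 // addr_ge0.
exists (P `&` Q `&`
  ([set y | `|f x - f y| < 1] `&` [set y | `|g x - g y| < 1])).
  by do !apply: filterI.
move=> y z [[Py Qy] [/= fy gy]] [[Pz Qz] [/= fz gz]].
have -> : f y * g y - f z * g z = f y * (g y - g z) + g z * (f y - f z) by ring.
have bnd (a b : R) : `|a - b| < 1 -> `|b| <= `|a| + 1.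
  move=> ab; rewrite -lerBlDl; apply: le_trans (ltW ab).
  by rewrite distrC; exact: lerB_dist.
apply: le_trans (ler_normD _ _) _; rewrite !normrM mulrDl -!mulrA.
by apply: lerD; apply: ler_pM; rewrite ?bnd ?kf ?lg.
Qed.

Lemma lipschitz_nearV (f : U -> R) :
  f x != 0 -> lipschitz_near F f -> lipschitz_near F (fun y => (f y)^-1).
Proof.
move=> fx0 fx; pose c := `|f x| / 2.
have c0 : 0 < c by rewrite divr_gt0 ?normr_gt0.
have /cvgrPdist_lt/(_ _ c0) fb := lipschitz_near_cvg Ax fx.
move: fx => [k k0 [P FP kf]].
exists (k / (c * c)); first by rewrite divr_ge0 // mulr_ge0 // ltW.
exists (P `&` [set y | `|f x - f y| < c]); first exact: filterI.
move=> y z [Py /= fy] [Pz /= fz].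
have bnd b : `|f x - b| < c -> c <= `|b|.
  move=> ab; have := lerB_dist (f x) b; move: ab; rewrite /c; lra.
have fyc := bnd _ fy; have fzc := bnd _ fz.
have fy0 : f y != 0 by rewrite -normr_gt0 (lt_le_trans c0).
have fz0 : f z != 0 by rewrite -normr_gt0 (lt_le_trans c0).
have -> : (f y)^-1 - (f z)^-1 = - (f y - f z) / (f y * f z).
  by field; rewrite ?fy0 ?fz0.
rewrite normrM normrN normfV normrM mulrAC.
apply: ler_pM; rewrite ?invr_ge0 ?mulr_ge0 //; first exact: kf.
rewrite lef_pV2 ?posrE ?mulr_gt0 ?normr_gt0 //.
by apply: ler_pM => //; exact: ltW.
Qed.

(** Lipschitz continuity of matrix functions is handled entry by entry, so that
    Lie derivatives reduce to sums and products of scalar functions. *)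
Lemma lipschitz_near_mulmx n m p (M : U -> 'M[R]_(n, m))
    (N : U -> 'M[R]_(m, p)) :
  (forall i j, lipschitz_near F (fun y => M y i j)) ->
  (forall i j, lipschitz_near F (fun y => N y i j)) ->
  forall i j, lipschitz_near F (fun y => (M y *m N y) i j).
Proof.
move=> MF NF i j.
under [X in lipschitz_near _ X]funext do rewrite mxE.
by apply: lipschitz_near_sum => k; exact: lipschitz_nearM.
Qed.

End Products.
End LipschitzNear.

(** * Continuously differentiable functions are locally Lipschitz *)

Lemma derive_gradient (R : realType) n (phi : 'cV[R]_n -> R) x v :
  differentiable phi x -> 'D_v phi x = \sum_i v i 0 * gradient phi x i 0.
Proof.
move=> dphi; rewrite deriveE // [in LHS](matrix_sum_delta v) linear_sum.
by apply: eq_bigr => i _; rewrite big_ord1 linearZ /= mxE deriveE.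
Qed.

Lemma is_derive_line (R : realType) n (phi : 'cV[R]_n -> R) y v (t : R) :
  differentiable phi (y + t *: v) ->
  is_derive t 1 (fun s : R => phi (y + s *: v)) ('D_v phi (y + t *: v)).
Proof.
move=> dphi.
(* The difference quotients of the two derivatives are the same function. *)
have quotE : (fun s : R => s^-1 *:
      (phi (y + (s *: (1 : R) + t) *: v) - phi (y + t *: v))) =
    (fun s : R => s^-1 *: (phi (s *: v + (y + t *: v)) - phi (y + t *: v))).
  by apply/funext => s; rewrite scalerDl addrCA [s *: 1]mulr1.
apply: DeriveDef.
  by have := @diff_derivable _ _ _ _ _ v dphi; rewrite /derivable quotE.
by rewrite /derive quotE.
Qed.

(** The gradient is bounded on a ball around x; as balls are convex, the mean
    value theorem applies along the segment between any two of its points. *)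
Lemma continuously_differentiable_lipschitz_near (R : realType) n
    (phi : 'cV[R]_n -> R) (x : 'cV[R]_n) :
  continuously_differentiable phi -> lipschitz_near (nbhs x) phi.
Proof.
move=> [dphi /(_ x)/cvgrPdist_lt/(_ _ ltr01)/nbhs_ballP[e /= e0 xe]].
pose K := `|gradient phi x| + 1.
have K0 : 0 <= K by rewrite addr_ge0.
(* The factor n bounds the pairing of the gradient with z - y, a sum of n terms,
   in terms of the sup norms. *)
exists (n%:R * K); first by rewrite mulr_ge0.
exists (ball x e); first exact: nbhsx_ballx.
move=> y z xy xz; rewrite distrC.
pose g (s : R) := phi (y + s *: (z - y)).
have dg (s : R) : is_derive s 1 g ('D_(z - y) phi (y + s *: (z - y))).
  exact: is_derive_line.
have [|c c01] := @MVT_segment _ g _ 0 1 ler01 (fun s _ => dg s).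
  apply: continuous_subspaceT => s; apply: differentiable_continuous.
  by apply/derivable1_diffP; have [] := dg s.
rewrite /g scale1r scale0r addr0 [y + _]addrC subrK subr0 mulr1 => ->.
rewrite derive_gradient //.
set p := y + c *: (z - y).
have xp : ball x e p.
  move: c01; rewrite in_itv /= => /andP[c0 c1].
  move: xy xz; rewrite -!ball_normE /= => xy xz.
  have -> : x - p = (1 - c) *: (x - y) + c *: (x - z).
    by apply/matrixP => i j; rewrite !mxE; ring.
  apply: le_lt_trans (ler_normD _ _) _; rewrite !normrZ !ger0_norm ?subr_ge0 //.
  apply: (@le_lt_trans _ _ (Num.max `|x - y| `|x - z|)).
    rewrite [leRHS](_ : _ = (1 - c) * Num.max `|x - y| `|x - z| +
      c * Num.max `|x - y| `|x - z|); last by ring.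
    by rewrite lerD // ler_wpM2l ?subr_ge0 // le_max lexx ?orbT.
  by rewrite gt_max xy.
have gK i : `|gradient phi p i 0| <= K.
  apply: le_trans (normr_entry _ _ _) _.
  have := ltW (xe _ xp); rewrite /K => gxp.
  rewrite -lerBlDl; apply: le_trans gxp.
  by rewrite distrC; exact: lerB_dist.
apply: le_trans (ler_norm_sum _ _ _) _.
apply: (@le_trans _ _ (\sum_(i < n) (K * `|y - z|))); last first.
  by rewrite sumr_const card_ord -mulrA mulr_natl.
apply: ler_sum => i _; rewrite normrM mulrC; apply: ler_pM => //.
by rewrite distrC; exact: normr_entry.
Qed.

(** * The scalar complementarity problem and the closed form *)

Lemma complementary_affine (R : realType) (q M u : R) : 0 < M ->
  complementary u (q + M * u) <-> u = Num.max (- (q / M)) 0.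
Proof.
move=> M0.
have qM : q = M * (q / M) by rewrite mulrC divfK // gt_eqF.
split=> [[u0 qu0 /eqP]|->].
  rewrite mulf_eq0 => /orP[/eqP u_0|/eqP qu].
    move: qu0; rewrite u_0 mulr0 addr0 => q0.
    by rewrite max_r // oppr_le0 divr_ge0 // ltW.
  have -> : - (q / M) = u.
    by apply: (mulfI (lt0r_neq0 M0)); rewrite mulrN -qM; lra.
  by rewrite max_l.
have [qM0|qM0] := leP 0 (q / M).
  rewrite max_r ?oppr_le0 //; split; rewrite ?mulr0 ?addr0 ?mul0r //.
  by rewrite qM mulr_ge0 // ltW.
rewrite max_l; last by rewrite oppr_ge0 ltW.
have -> : q + M * - (q / M) = 0 by rewrite mulrN -qM subrr.
by split; rewrite ?mulr0 // oppr_ge0 ltW.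
Qed.

(** The case M = 0 is included: it occurs where L_G V vanishes. *)
Lemma complementary_slack (R : realType) (q M u : R) : 0 < q -> 0 <= M ->
  complementary u (q + M * u) <-> u = 0.
Proof.
move=> q0 M0; split=> [[u0 _ /eqP]|->].
  rewrite mulf_eq0 => /orP[/eqP //|/eqP qu].
  by have := ltr_pwDl q0 (mulr_ge0 M0 u0); rewrite qu ltxx.
by split; rewrite ?mulr0 ?addr0 ?mul0r ?(ltW q0).
Qed.

Lemma rowdot_comb (R : realType) m (a : 'rV[R]_m) (w1 w2 : 'cV[R]_m) (c d : R) :
  rowdot a (c *: w1 + d *: w2) = rowdot a w1 * c + rowdot a w2 * d.
Proof.
rewrite /rowdot mulmxDr -!scalemxAr.
move: (a *m w1) (a *m w2) => u v.
by rewrite !mxE (mulrC c) (mulrC d).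
Qed.

Section ClosedForm.
Variables (R : realType) (n m : nat).
Variables (f : 'cV[R]_n -> 'cV[R]_n) (G : 'cV[R]_n -> 'M[R]_(n, m)).

(** Where the input has no influence on V, the CLF inequality is a statement about
    the drift alone. *)
Lemma CLF_residual_le0 (D : set 'cV[R]_n) V alpha x :
  is_CLF f G D V alpha -> (D `\ 0) x -> lieG G V x = 0 ->
  residual f V alpha x <= 0.
Proof.
move=> [_ _ _ clf] Dx LGV0.
have := clf _ Dx.
rewrite /residual -lerBrDr sub0r -lee_fin; apply: le_trans.
by apply: le_ereal_inf_tmp => _ [u _ <-]; rewrite LGV0 /rowdot mul0mx mxE addr0.
Qed.

Variables (V : 'cV[R]_n -> R) (alpha : R -> R) (w : 'cV[R]_n -> 'cV[R]_m).

(** A formula without case distinction, hence the one that shows Lipschitz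
    continuity across the zero set of F_l; it is also the solution given by
    [complementary_affine]. *)
Lemma ubar_l_max x : rowdot (lieG G V x) (w x) < 0 ->
  ubar_l f G V alpha w x =
  Num.max (- (residual f V alpha x / rowdot (lieG G V x) (w x))) 0.
Proof.
move=> L0; rewrite /ubar_l.
have [F0|F0] := leP 0; [rewrite max_l|rewrite max_r] => //.
  by rewrite oppr_ge0 mulr_ge0_le0 // invr_le0 ltW.
by rewrite oppr_le0 mulr_le0 ?invr_le0 ?(ltW F0) ?(ltW L0).
Qed.

End ClosedForm.

(** * Lie derivatives and residuals *)

Section LocallyLipschitzData.
Variables (R : realType) (n m : nat).
Variables (f : 'cV[R]_n -> 'cV[R]_n) (G : 'cV[R]_n -> 'M[R]_(n, m)).
Variables (A : set 'cV[R]_n) (phi : 'cV[R]_n -> R).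
Hypotheses (f_lip : locally_lipschitz [set: 'cV[R]_n] f)
  (G_lip : locally_lipschitz [set: 'cV[R]_n] G)
  (grad_lip : locally_lipschitz A (gradient phi))
  (phi_C1 : continuously_differentiable phi).
Variables (x : 'cV[R]_n).
Hypothesis Ax : A x.
Let F := within A (nbhs x).

Lemma lipschitz_near_grad_tr i j :
  lipschitz_near F (fun y => (gradient phi y)^T i j).
Proof.
under [X in lipschitz_near _ X]funext do rewrite mxE.
by apply: lipschitz_near_entry; exact: locally_lipschitz_near.
Qed.

Lemma lipschitz_near_lieF : lipschitz_near F (lieF f phi).
Proof.
apply: lipschitz_near_mulmx => // i j; first exact: lipschitz_near_grad_tr.
by apply: lipschitz_near_entry; exact: locally_lipschitz_setT_near.
Qed.

Lemma lipschitz_near_lieG i j : lipschitz_near F (fun y => lieG G phi y i j).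
Proof.
apply: lipschitz_near_mulmx => // {}i {}j; first exact: lipschitz_near_grad_tr.
by apply: lipschitz_near_entry; exact: locally_lipschitz_setT_near.
Qed.

Lemma lipschitz_near_rowdot_lieG (w : 'cV[R]_n -> 'cV[R]_m) :
  locally_lipschitz A w ->
  lipschitz_near F (fun y => rowdot (lieG G phi y) (w y)).
Proof.
move=> w_lip; apply: lipschitz_near_mulmx => // i j.
  exact: lipschitz_near_lieG.
by apply: lipschitz_near_entry; exact: locally_lipschitz_near.
Qed.

(** The set B is the domain on which the comparison function is Lipschitz: the
    half-line [0, +oo[ for alpha_l, the whole line for alpha_h. *)
Lemma lipschitz_near_residual (alpha : R -> R) (B : set R) :
  (forall y, A y -> B (phi y)) ->
  locally_lipschitz (B : set R^o) (alpha : R^o -> R^o) ->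
  lipschitz_near F (residual f phi alpha).
Proof.
move=> AB alpha_lip; apply: lipschitz_nearD; first exact: lipschitz_near_lieF.
apply: (@lipschitz_near_comp R _ R^o R^o A B phi alpha) => //.
  apply: lipschitz_near_within.
  exact: continuously_differentiable_lipschitz_near.
by apply: locally_lipschitz_near => //; exact: AB.
Qed.

End LocallyLipschitzData.

(** * The complementarity problem *)

Theorem theorem1 (R : realType) (n m : nat)
    (f : 'cV[R]_n -> 'cV[R]_n) (G : 'cV[R]_n -> 'M[R]_(n, m))
    (D : set 'cV[R]_n)
    (V h : 'cV[R]_n -> R) (alpha_l alpha_h : R -> R)
    (w_l w_h : 'cV[R]_n -> 'cV[R]_m)
    (f_lip : locally_lipschitz [set: 'cV[R]_n] f)
    (G_lip : locally_lipschitz [set: 'cV[R]_n] G)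
    (f0 : f 0 = 0)
    (D_open : open D) (D_connected : connected D) (D0 : D 0)
    (V_CLF : is_CLF f G D V alpha_l)
    (h_CBF : is_CBF f G D h alpha_h)
    (C_sub_D : [set x | 0 <= h x] `<=` D)
    (h0_gt0 : 0 < h 0)
    (LGh_neq0 : forall x, D x -> lieG G h x != 0)
    (hyp_a : forall x, (D `\ 0) x ->
       residual f V alpha_l x = 0 -> lieG G V x != 0)
    (hyp_b : forall x, (D `\ 0) x ->
       lieG G V x != 0 -> 0 < - rowdot (lieG G V x) (w_l x))
    (hyp_c : forall x, (D `\ 0) x -> 0 < rowdot (lieG G h x) (w_h x)) :
  (forall x, (D `\ 0) x -> forall ul uh : R,
     solves_LCP f G V h alpha_l alpha_h w_l w_h x ul uh <->
     ul = ubar_l f G V alpha_l w_l x /\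
     uh = ubar_h f G V h alpha_l alpha_h w_l w_h x)
  /\
  (locally_lipschitz (D `\ 0) w_l ->
   locally_lipschitz (D `\ 0) w_h ->
   locally_lipschitz (D `\ 0) (gradient V) ->
   locally_lipschitz (D `\ 0) (gradient h) ->
   locally_lipschitz (`[0, +oo[%classic : set R^o) (alpha_l : R^o -> R^o) ->
   locally_lipschitz [set: R^o] (alpha_h : R^o -> R^o) ->
   locally_lipschitz (D `\ 0) (ubar_l f G V alpha_l w_l : 'cV[R]_n -> R^o) /\
   locally_lipschitz (D `\ 0)
     (ubar_h f G V h alpha_l alpha_h w_l w_h : 'cV[R]_n -> R^o)).
Proof.
have L_lt0 x : (D `\ 0) x -> 0 <= residual f V alpha_l x ->
    rowdot (lieG G V x) (w_l x) < 0.
  move=> Dx F0; rewrite -oppr_gt0; apply: hyp_b => //.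
  apply/eqP => LGV0; have Fle0 := CLF_residual_le0 V_CLF Dx LGV0.
  by have /eqP := hyp_a _ Dx (le_anti (introT andP (conj Fle0 F0))).
have L_le0 x : (D `\ 0) x -> rowdot (lieG G V x) (w_l x) <= 0.
  move=> Dx; have [LGV0|LGV0] := eqVneq (lieG G V x) 0.
    by rewrite LGV0 /rowdot mul0mx mxE.
  by rewrite -oppr_ge0 ltW // hyp_b.
have lcp_l x ul : (D `\ 0) x ->
    complementary ul (- residual f V alpha_l x -
      rowdot (lieG G V x) (w_l x) * ul) <->
    ul = ubar_l f G V alpha_l w_l x.
  move=> Dx; rewrite -mulNr.
  have [F0|F0] := leP 0 (residual f V alpha_l x).
    have L0 := L_lt0 _ Dx F0.
    rewrite ubar_l_max // complementary_affine ?oppr_gt0 //.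
    by rewrite invrN mulrNN.
  rewrite complementary_slack ?oppr_gt0 ?oppr_ge0 ?L_le0 //.
  by rewrite /ubar_l leNgt F0.
have lcp_h x ul uh : (D `\ 0) x ->
    complementary uh (residual f h alpha_h x +
      rowdot (lieG G h x) (ul *: w_l x + uh *: w_h x)) <->
    uh = Num.max (- ((residual f h alpha_h x + rowdot (lieG G h x) (w_l x) * ul) /
        rowdot (lieG G h x) (w_h x))) 0.
  move=> Dx; rewrite -complementary_affine ?hyp_c //.
  by rewrite rowdot_comb addrA.
split=> [x Dx ul uh|wl_lip wh_lip gV_lip gh_lip al_lip ah_lip].
  rewrite /solves_LCP /ubar_h lcp_l // lcp_h //.
  by split=> -[-> ->].
have [V_C1 [V0 V_gt0] _ _] := V_CLF; have [h_C1 _ _] := h_CBF.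
have V_ge0 y : (D `\ 0) y -> `[0, +oo[%classic (V y).
  by move=> [_ /eqP y0]; rewrite /= in_itv /= andbT ltW // V_gt0.
have Fl_lip x (Dx : (D `\ 0) x) :=
  lipschitz_near_residual f_lip gV_lip V_C1 Dx V_ge0 al_lip.
have Fh_lip x (Dx : (D `\ 0) x) :=
  lipschitz_near_residual f_lip gh_lip h_C1 Dx (fun _ _ => I) ah_lip.
have ul_lip x : (D `\ 0) x ->
    lipschitz_near (within (D `\ 0) (nbhs x)) (ubar_l f G V alpha_l w_l).
  move=> Dx.
  have Fl_cvg := lipschitz_near_cvg Dx (Fl_lip x Dx).
  have [F0|F0] := leP 0 (residual f V alpha_l x).
    have L0 := L_lt0 _ Dx F0.
    have L_lip := lipschitz_near_rowdot_lieG G_lip gV_lip Dx wl_lip.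
    have L_cvg := lipschitz_near_cvg Dx L_lip.
    have ratio_lip : lipschitz_near (within (D `\ 0) (nbhs x)) (fun y =>
        Num.max (- (residual f V alpha_l y / rowdot (lieG G V y) (w_l y))) 0).
      apply/lipschitz_near_max0/lipschitz_nearN.
      apply: (lipschitz_nearM Dx (Fl_lip x Dx)).
      by apply: (lipschitz_nearV Dx _ L_lip); rewrite lt_eqF.
    apply: lipschitz_near_eq ratio_lip.
    have : \forall y \near within (D `\ 0) (nbhs x),
        rowdot (lieG G V y) (w_l y) < 0.
      exact: (L_cvg [set r | r < 0] (lt_nbhsl L0)).
    by apply: filterS => y Ly; rewrite ubar_l_max.
  apply: lipschitz_near_eq (lipschitz_near_cst (0 : R)).
  have : \forall y \near within (D `\ 0) (nbhs x), residual f V alpha_l y < 0.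
    exact: (Fl_cvg [set r | r < 0] (lt_nbhsl F0)).
  by apply: filterS => y Fy; rewrite /ubar_l leNgt Fy.
split; apply/locally_lipschitzP => x Dx; first exact: ul_lip.
apply: lipschitz_near_max0; apply: lipschitz_nearN.
apply: lipschitz_nearM => //; last first.
  apply: lipschitz_nearV => //; first by rewrite gt_eqF // hyp_c.
  exact: lipschitz_near_rowdot_lieG.
apply: lipschitz_nearD; first exact: Fh_lip.
apply: lipschitz_nearM => //; last exact: ul_lip.
exact: lipschitz_near_rowdot_lieG.
Qed.
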